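(* For every $n\ge1$ there exists an $(n-1,n)$-stopping rule with stopping time $\tau$ such that for every distribution $F$ on $\mathbb{R}_+$, when the samples and $X_1,\dots,X_n$ are i.i.d.\ from $F$, \[ \mathbb{E}[X_\tau]\ge\frac12\cdot\mathbb{E}[\max\{X_1,\dots,X_n\}]. \]
   Context: Let $k\in\mathbb{N}_0$, $n\in\mathbb{N}$. Values $X_1,\dots,X_n$ and samples $S_1,\dots,S_k$ are i.i.d.\ according to a distribution $F$ on $\mathbb{R}_+$ (unknown to the rule). A $(k,n)$-stopping rule is a family $r_1,\dots,r_n$, $r_i:\mathbb{R}_+^{k+i}\to[0,1]$, where $r_i(s_1,\dots,s_k,x_1,\dots,x_i)$ is the probability of stopping at $X_i$ given samples $s$, values $x_1,\dots,x_i$, and not having stopped earlier; the rule does not depend on $F$. Its stopping time $\tau$ satisfies $\Pr[\tau=i\mid S=s,X=x]=\prod_{j<i}(1-r_j(s,x_1,\dots,x_j))\,r_i(s,x_1,\dots,x_i)$, with $X_\infty:=0$. *)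

(* Defs.v *)
From HB Require Import structures.
From mathcomp Require Import all_boot all_order all_algebra.
From mathcomp Require Import all_classical all_reals all_analysis.

Set Implicit Arguments.
Unset Strict Implicit.
Unset Printing Implicit Defensive.

Import Order.TTheory GRing.Theory Num.Theory.

Local Open Scope classical_set_scope.
Local Open Scope ring_scope.

Definition nonneg_orthant (R : realType) (m : nat) : set (m.-tuple R) :=
  [set t | forall j, 0 <= tnth t j].

(* Times are numbered from 0: [r i] decides on the (i+1)-st value. It sees the
   k samples followed by the first i+1 values, and its values off the
   nonnegative orthant are irrelevant. The Borel measurability of [r i], implicit
   on paper, makes the law of the stopping time meaningful. *)
Record stopping_rule (R : realType) (k n : nat) := StoppingRule {
  stop_prob :> forall i : 'I_n, (k + i.+1).-tuple R -> R ;
  stop_prob_itv : forall (i : 'I_n) (t : (k + i.+1).-tuple R),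
    nonneg_orthant t -> 0 <= @stop_prob i t <= 1 ;
  stop_prob_measurable : forall i : 'I_n,
    measurable_fun (@nonneg_orthant R (k + i.+1)) (@stop_prob i) }.
Arguments stop_prob {R k n} _ i t.

Definition history (R : realType) (k n : nat) (s : k.-tuple R) (x : n.-tuple R)
    (i : 'I_n) : (k + i.+1).-tuple R :=
  [tuple of s ++ [tuple tnth x (widen_ord (ltn_ord i) j) | j < i.+1]].

Definition stop_at_prob (R : realType) (k n : nat) (r : stopping_rule R k n)
    (s : k.-tuple R) (x : n.-tuple R) (i : 'I_n) : R :=
  (\prod_(j < n | (j < i)%N) (1 - r j (history s x j))) * r i (history s x i).

Section Probability.
Context (d : measure_display) (Omega : measurableType d) (R : realType).
Variable P : probability Omega R.

Definition mutually_independent (I : finType) (Z : I -> {RV P >-> R}) : Prop :=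
  forall (J : {set I}) (B : I -> set R), (forall i, measurable (B i)) ->
    P (\bigcap_(i in [set` J]) (Z i @^-1` B i)) =
    (\prod_(i in J) P (Z i @^-1` B i))%E.

Definition iid (I : finType) (F : probability R R)
    (Z : I -> {RV P >-> R}) : Prop :=
  mutually_independent Z /\
  forall i (B : set R), measurable B -> distribution P (Z i) B = F B.

Definition samples_and_values (k n : nat) (S : 'I_k -> {RV P >-> R})
    (X : 'I_n -> {RV P >-> R}) (i : 'I_k + 'I_n) : {RV P >-> R} :=
  match i with inl j => S j | inr j => X j end.

Definition observe (m : nat) (Z : 'I_m -> {RV P >-> R}) (w : Omega) :
    m.-tuple R :=
  [tuple Z j w | j < m].

(* [None] is the value "infinity" of tau. The second condition says that
   (s, x) |-> stop_at_prob r s x i is a version on the nonnegative orthant of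
   the conditional probability of tau = i given (S, X) = (s, x). *)
Definition stopping_time_of (k n : nat) (r : stopping_rule R k n)
    (S : 'I_k -> {RV P >-> R}) (X : 'I_n -> {RV P >-> R})
    (tau : Omega -> option 'I_n) : Prop :=
  forall i : 'I_n,
    measurable [set w | tau w = Some i] /\
    forall A : set (k.-tuple R * n.-tuple R), measurable A ->
      A `<=` @nonneg_orthant R k `*` @nonneg_orthant R n ->
      let SX_in_A := [set w | A (observe S w, observe X w)] in
      P ([set w | tau w = Some i] `&` SX_in_A) =
      (\int[P]_(w in SX_in_A)
         (stop_at_prob r (observe S w) (observe X w) i)%:E)%E.

Definition stopped_value (n : nat) (X : 'I_n -> {RV P >-> R})
    (tau : Omega -> option 'I_n) (w : Omega) : R :=
  if tau w is Some i then X i w else 0.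

(* The default value 0 is harmless, as it is only used for n > 0 and almost
   surely nonnegative values. *)
Definition max_value (n : nat) (X : 'I_n -> {RV P >-> R}) (w : Omega) : R :=
  \big[Num.max/0]_(i < n) X i w.

End Probability.

(* Main.v *)
(* Stop at the i-th value when it is the maximum of the last n observations
   (samples included), with probability one over the number of ties. Let w_i be
   this probability. The n weights of one window sum to 1, so by exchangeability
   n E[X_i w_i] = E[max]. Given that X_i is the maximum of its window, exchanging
   an earlier X_j with the maximum of the window of j can only help X_i to be
   maximal, so n E[X_i w_i w_j] <= E[X_i w_i] for j < i. As the probability of
   stopping at i is at least w_i (1 - sum_(j < i) w_j), the rule earns at least
   sum_i (1 - (i - 1) / n) E[max] / n = (n + 1) / (2 n) E[max]. *)
Require Import Defs.
From mathcomp Require Import all_boot all_order all_algebra.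
From mathcomp Require Import all_classical all_reals all_analysis.
From mathcomp Require Import perm measurable_realfun.
From mathcomp Require Import ring lra zify.

Set Implicit Arguments.
Unset Strict Implicit.
Unset Printing Implicit Defensive.

Import Order.TTheory GRing.Theory Num.Theory.

Local Open Scope classical_set_scope.
Local Open Scope ring_scope.

(** * Weights that split one unit equally among the maximizers of a finite family *)

Section ArgmaxWeight.
Context (R : realFieldType) (I : finType).
Implicit Types (y : I -> R) (a b : I).

(** Writing the test for maximality as a product of indicators reduces measurability to closure
    under products, sums and reciprocals. *)
Definition argmax_weight y a : R :=
  (\prod_b (y b <= y a)%R%:R) / \sum_b (y b == y a)%:R.

Lemma argmax_weightE y a : argmax_weight y a =
  if [forall b, y b <= y a] then (\sum_b (y b == y a)%:R)^-1 else 0.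
Proof.
rewrite /argmax_weight; case: ifPn => [/forallP ya|/forallPn[b yb]].
  by rewrite big1 ?mul1r// => b _; rewrite ya.
by rewrite (bigD1 b)//= (negbTE yb) mul0r mul0r.
Qed.

Lemma tie_count_ge1 y a : 1 <= \sum_b (y b == y a)%:R :> R.
Proof. by rewrite (bigD1 a)//= eqxx lerDl sumr_ge0. Qed.

Lemma argmax_weight_itv y a : 0 <= argmax_weight y a <= 1.
Proof.
rewrite argmax_weightE; case: ifPn => _; last by rewrite lexx ler01.
have c1 := tie_count_ge1 y a.
by rewrite invr_ge0 (le_trans ler01 c1) invf_le1// (lt_le_trans ltr01).
Qed.

Lemma argmax_weight_ge0 y a : 0 <= argmax_weight y a.
Proof. by have /andP[] := argmax_weight_itv y a. Qed.

Lemma argmax_weight_neq0 y a b : argmax_weight y a != 0 -> y b <= y a.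
Proof. by rewrite argmax_weightE; case: ifPn => [/forallP//|_]; rewrite eqxx. Qed.

Lemma sum_argmax_weight y : (0 < #|I|)%N -> \sum_a argmax_weight y a = 1.
Proof.
move=> /card_gt0P[i0 _].
have [m _ ym] := @Order.TotalTheory.arg_maxP _ R I i0 predT y isT.
set c : R := \sum_b (y b == y m)%:R.
rewrite (eq_bigr (fun a => (y a == y m)%:R / c)) => [|a _].
  by rewrite -mulr_suml mulfV// gt_eqF// (lt_le_trans ltr01 (tie_count_ge1 y m)).
rewrite argmax_weightE; have [->|yam] := eqVneq (y a) (y m).
  by rewrite mul1r ifT//; apply/forallP => b; exact: ym.
rewrite mul0r ifF//; apply/negbTE/forallPn; exists m.
by rewrite -ltNge lt_neqAle yam; exact: ym.
Qed.

Lemma argmax_weight_comp y (p : {perm I}) a :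
  argmax_weight (y \o p) a = argmax_weight y (p a).
Proof.
rewrite /argmax_weight [in RHS](reindex_inj (@perm_inj _ p))/=; congr (_ / _).
by rewrite [RHS](reindex_inj (@perm_inj _ p)).
Qed.

(** If [a] is maximal for [z], it is so for the smaller [y]. A tie [y b = y a] is then also a tie of
    [z], because [y b <= z b <= z a = y a]. So [y] has at most as many ties as [z]. *)
Lemma le_argmax_weight y z a : (forall b, y b <= z b) -> z a = y a ->
  argmax_weight z a <= argmax_weight y a.
Proof.
move=> yz zya; rewrite [leLHS]argmax_weightE.
case: ifPn => [/forallP za|_]; last exact: argmax_weight_ge0.
rewrite argmax_weightE ifT; last first.
  by apply/forallP => b; rewrite -zya (le_trans (yz b)).
rewrite lef_pV2 ?posrE ?(lt_le_trans ltr01 (tie_count_ge1 _ _))//.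
apply: ler_sum => b _; have [yb|] := eqVneq (y b) (y a); last by rewrite ler0n.
suff -> : z b == z a by [].
by rewrite eq_le za zya -yb yz.
Qed.

(** The weights sum to 1 and charge only indices where [y] is maximal. Truncating at 0 matches the
    default of the maximum, so no sign condition on [y] arises. *)
Lemma le_sum_argmax_weight y : (0 < #|I|)%N ->
  \big[Num.max/0]_a y a <= \sum_a Num.max (y a) 0 * argmax_weight y a.
Proof.
move=> I0; apply: bigmax_le => [|b _].
  by apply: sumr_ge0 => a _; rewrite mulr_ge0 ?argmax_weight_ge0// le_max lexx orbT.
rewrite -[leLHS]mulr1 -(sum_argmax_weight y I0) mulr_sumr.
apply: ler_sum => a _; have [->|/argmax_weight_neq0 yba] := eqVneq (argmax_weight y a) 0.
  by rewrite !mulr0.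
by rewrite ler_wpM2r ?argmax_weight_ge0// le_max yba.
Qed.

End ArgmaxWeight.

(* The swap of [s a] and [s l] changes nothing in the window [w] if it permutes
   it, and otherwise only replaces the entry [s l] of [w] by a larger one,
   because [a] carries positive weight in [s] only if it is a maximum there. *)
Lemma argmax_weight_swap (R : realFieldType) (K I J : finType) (z : K -> R)
    (s : I -> K) (w : J -> K) (l a : I) (m : J) :
  injective s -> injective w -> w m != s a -> w m != s l ->
  (forall b, w b = s a -> exists c, w c = s l) ->
  argmax_weight (z \o tperm (s a) (s l) \o w) m *
    argmax_weight (z \o tperm (s a) (s l) \o s) l <=
  argmax_weight (z \o w) m * argmax_weight (z \o s) a.
Proof.
move=> sI wI wma wml sw.
have -> : z \o tperm (s a) (s l) \o s = z \o s \o tperm a l.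
  by apply/funext => b /=; rewrite -(inj_tperm _ _ _ sI).
rewrite argmax_weight_comp tpermR.
have [->|a0] := eqVneq (argmax_weight (z \o s) a) 0; first by rewrite !mulr0.
rewrite ler_wpM2r ?argmax_weight_ge0//.
have [/existsP[b /eqP wb]|nsa] := boolP [exists b, w b == s a].
  have [c wc] := sw _ wb.
  have -> : z \o tperm (s a) (s l) \o w = z \o w \o tperm b c.
    by apply/funext => e /=; rewrite -wb -wc -(inj_tperm _ _ _ wI).
  rewrite argmax_weight_comp tpermD// -(inj_eq wI) ?wb ?wc eq_sym//.
apply: le_argmax_weight => [b|] /=; last by rewrite tpermD// eq_sym.
case: tpermP => [wb|->|//]; last exact: (argmax_weight_neq0 (y := z \o s) l a0).
by case/existsP: nsa; exists b; rewrite wb.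
Qed.

(** * Measurability of weights and maxima *)

Lemma measurable_argmax_weight d (T : measurableType d) (R : realType)
    (I : finType) (f : I -> T -> R) (a : I) :
  (forall i, measurable_fun setT (f i)) ->
  measurable_fun setT (fun x => argmax_weight (fun i => f i x) a).
Proof.
move=> mf.
have mB (b : T -> bool) : measurable_fun setT b ->
    measurable_fun setT (fun x => (b x)%:R : R).
  by move=> mb; apply: (@measurableT_comp _ _ _ _ _ _ (fun c : bool => c%:R : R)).
apply: measurable_funM.
  by apply: measurable_prod => b _; apply: mB; exact: measurable_fun_ler.
(* The reciprocal of the tie count is expressed as a real power, whose measurability is known. *)
rewrite (_ : (fun x => _) =
    (fun x => (\sum_b (f b x == f a x)%:R) `^ (-1))); last first.
  by apply/funext => x; rewrite powR_inv1// sumr_ge0.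
apply: (@measurableT_comp _ _ _ _ _ _ (@powR R ^~ (-1))) => //.
by apply: measurable_sum => b; apply: mB; exact: measurable_fun_eqr.
Qed.

Lemma measurable_bigmaxr d (T : measurableType d) (R : realType) (I : Type)
    (s : seq I) (f : I -> T -> R) :
  (forall i, measurable_fun setT (f i)) ->
  measurable_fun setT (fun x => \big[Num.max/0]_(i <- s) f i x).
Proof.
move=> mf; elim: s => [|i s IHs].
  by rewrite (_ : (fun x => _) = cst 0)//; apply/funext => x; rewrite big_nil.
rewrite (_ : (fun x => _) = f i \max (fun x => \big[Num.max/0]_(i <- s) f i x)).
  exact: measurable_maxr.
by apply/funext => x; rewrite big_cons.
Qed.

(** * Joint laws and integration against them *)

Definition rectangle (T : Type) (m : nat) (B : 'I_m -> set T) : set (m.-tuple T) :=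
  [set t | forall i, B i (tnth t i)].

Lemma measurable_rectangle d (T : measurableType d) (m : nat) (B : 'I_m -> set T) :
  (forall i, measurable (B i)) -> measurable (rectangle B).
Proof.
move=> mB.
rewrite (_ : rectangle B = \bigcap_(i in [set: 'I_m]) (@tnth _ T ^~ i @^-1` B i)).
  apply: fin_bigcap_measurable; first exact: finite_finset.
  by move=> i _; rewrite -[_ @^-1` _]setTI; exact: measurable_tnth.
by apply/seteqP; split=> [t tB i _|t tB i]; [exact: tB|exact: (tB i I)].
Qed.

(** Rectangles are stable under intersection, so this makes them a generating pi-system on which two
    laws of tuples need only be compared. *)
Lemma tuple_measurable_rectangles d (T : measurableType d) (m : nat) :
  (measurable : set (set (m.-tuple T))) =
  <<s [set rectangle B | B in [set B : 'I_m -> set T | forall i, measurable (B i)]] >>.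
Proof.
apply/seteqP; split; last first.
  apply: smallest_sub; first exact: sigma_algebra_measurable.
  by move=> _ [B mB <-]; exact: measurable_rectangle.
apply: smallest_sub; first exact: smallest_sigma_algebra.
rewrite -bigcup_seq => _ [i _ [Y mY <-]]; apply: sub_sigma_algebra.
(* A cylinder over one coordinate is a rectangle whose other sides are full. *)
exists (fun j => if j == i then Y else setT) => [j|].
  by case: ifP.
apply/seteqP; split=> t /=.
  by move=> /(_ i); rewrite eqxx.
by move=> [_ Yt] j; case: eqP => [->|].
Qed.

Section Law.
Context d (Omega : measurableType d) (R : realType) (P : probability Omega R).

Lemma measurable_observe m (Z : 'I_m -> {RV P >-> R}) :
  measurable_fun setT (observe Z).
Proof.
apply/measurable_fun_tnthP => i.
by rewrite (_ : _ \o _ = Z i)//; apply/funext => w /=; rewrite tnth_mktuple.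
Qed.

(** Both sides are integrals of [f] against pushforward laws, which agree on rectangles and hence
    everywhere. *)
Lemma eq_integral_observe m (Y Z : 'I_m -> {RV P >-> R})
    (f : m.-tuple R -> \bar R) :
  (forall B : 'I_m -> set R, (forall i, measurable (B i)) ->
    P (\bigcap_i (Y i @^-1` B i)) = P (\bigcap_i (Z i @^-1` B i))) ->
  measurable_fun setT f -> (forall t, 0 <= f t)%E ->
  (\int[P]_w f (observe Y w) = \int[P]_w f (observe Z w))%E.
Proof.
move=> YZ mf f0.
have preimage_observe (W : 'I_m -> {RV P >-> R}) (B : 'I_m -> set R) :
    observe W @^-1` rectangle B = \bigcap_i (W i @^-1` B i).
  apply/seteqP; split=> w /= wB i => [_|].
    by have := wB i; rewrite tnth_mktuple.
  by rewrite tnth_mktuple; exact: wB.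
have mY := measurable_observe Y; have mZ := measurable_observe Z.
have f0T : {in [set: m.-tuple R], forall t, 0 <= f t}%E by move=> t _.
rewrite -(@ge0_integral_pushforward _ _ _ _ _ _ mY P _ _ measurableT mf f0T).
rewrite -(@ge0_integral_pushforward _ _ _ _ _ _ mZ P _ _ measurableT mf f0T).
apply: eq_measure_integral => A mA _.
apply: (measure_unique _ (fun _ => setT) (tuple_measurable_rectangles R m)) => //.
- move=> _ _ [B mB <-] [C mC <-]; exists (fun i => B i `&` C i).
    by move=> i; exact: measurableI.
  apply/seteqP; split=> [t BC|t [tB tC] i]; last by split.
  by split=> i; have [] := BC i.
- by move=> _; exists (fun _ => setT) => //; apply/seteqP; split.
- by rewrite bigcup_const.
- move=> _ [B mB <-]; have := YZ B mB.
  by rewrite -(preimage_observe Y) -(preimage_observe Z).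
- by move=> _; change (P setT < +oo)%E; rewrite probability_setT ltry.
Qed.

Import HBNNSimple.

(** Simple functions increasing to [phi], composed with [X], and monotone convergence show that the
    integral depends on [f] only through its integrals over sets [D] intersected with preimages
    under [X]. *)
Lemma ge0_integral_comp_simple (D : set Omega) (X f : Omega -> R)
    (phi : R -> \bar R) :
  measurable D -> measurable_fun setT X -> measurable_fun setT f ->
  (forall w, 0 <= f w) -> forall (mphi : measurable_fun setT phi),
  (forall x, 0 <= phi x)%E ->
  let h := nnsfun_approx (@measurableT _ R) mphi in
  (\int[P]_(w in D) (phi (X w) * (f w)%:E) =
   limn (fun n => \sum_(y \in range (h n))
     (y%:E * \int[P]_(w in D `&` X @^-1` (h n @^-1` [set y])) (f w)%:E)))%E.
Proof.
move=> mD mX mf f0 mphi phi0 h.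
have mh n : measurable_fun setT (fun w => h n (X w)).
  by apply: (@measurableT_comp _ _ _ _ _ _ (h n)).
have mhD n r : measurable (X @^-1` (h n @^-1` [set r])).
  by rewrite -[X @^-1` _]setTI; apply: mX => //; exact: measurable_funPTI.
transitivity (\int[P]_(w in D) limn (fun n => (h n (X w) * f w)%:E))%E.
  apply: eq_integral => w _; apply/esym/cvg_lim => //.
  rewrite (_ : (fun n => _) = (fun n => (h n (X w))%:E * (f w)%:E)%E)//.
  by apply: cvgeZr => //; exact: (@cvg_nnsfun_approx _ _ _ _ measurableT _ mphi).
rewrite monotone_convergence//.
- congr (limn _); apply/funext => n.
  (* The simple function is decomposed along its finitely many values. *)
  transitivity (\int[P]_(w in D) (\sum_(y \in range (h n))
      (y * \1_(h n @^-1` [set y]) (X w) * f w)%:E))%E.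
    apply: eq_integral => w _; rewrite fsumEFin// -mulr_fsuml.
    by rewrite [in LHS](fimfunE (h n) (X w)).
  have mterm y : measurable_fun D
      (fun w => (y * \1_(h n @^-1` [set y]) (X w) * f w)%:E).
    apply/measurable_EFinP/measurable_funTS/measurable_funM => //.
    apply: measurable_funM => //.
    rewrite (_ : (fun w => \1_(h n @^-1` [set y]) (X w)) =
      \1_(X @^-1` (h n @^-1` [set y]))); first exact: measurable_indic.
    by apply/funext => w; rewrite !indicE.
  rewrite ge0_integral_fsum//; last first.
    move=> y w _; rewrite EFinM mule_ge0 ?lee_fin//.
    exact: (nnfun_muleindic_ge0 (h n)).
  apply: eq_fsbigr => y /set_mem[x _ hx].
  have y0 : 0 <= y by rewrite -hx.
  rewrite -ge0_integralZl_EFin//; last 3 first.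
  + exact: measurableI.
  + by move=> w _; rewrite lee_fin.
  + by apply/measurable_EFinP; exact: measurable_funTS.
  rewrite integral_mkcondr; apply: eq_integral => w _.
  rewrite patchE indicE.
  have -> : (w \in X @^-1` (h n @^-1` [set y])) = (X w \in h n @^-1` [set y]) by [].
  by case: (_ \in _); rewrite ?mulr1// mulr0 mul0r.
- by move=> n; apply/measurable_EFinP/measurable_funTS/measurable_funM.
- by move=> n w _; rewrite lee_fin mulr_ge0.
- move=> w _ a b ab; rewrite lee_fin ler_wpM2r//.
  exact/lefP/nd_nnsfun_approx.
Qed.

(** Serves to replace the indicator of stopping at a given time by its conditional probability when
    integrating a function of the current value. *)
Lemma ge0_integral_comp_eq (D : set Omega) (X f1 f2 : Omega -> R)
    (phi : R -> \bar R) :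
  measurable D -> measurable_fun setT X ->
  measurable_fun setT f1 -> measurable_fun setT f2 ->
  (forall w, 0 <= f1 w) -> (forall w, 0 <= f2 w) ->
  (forall B, measurable B ->
    \int[P]_(w in D `&` X @^-1` B) (f1 w)%:E =
    \int[P]_(w in D `&` X @^-1` B) (f2 w)%:E)%E ->
  measurable_fun setT phi -> (forall x, 0 <= phi x)%E ->
  (\int[P]_(w in D) (phi (X w) * (f1 w)%:E) =
   \int[P]_(w in D) (phi (X w) * (f2 w)%:E))%E.
Proof.
move=> mD mX mf1 mf2 f10 f20 f12 mphi phi0.
rewrite (ge0_integral_comp_simple mD mX mf1 f10 mphi phi0).
rewrite (ge0_integral_comp_simple mD mX mf2 f20 mphi phi0).
congr (limn _); apply/funext => n; apply: eq_fsbigr => y _; congr (_ * _)%E.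
by apply: f12; exact: measurable_funPTI.
Qed.

End Law.

(** The Weierstrass product inequality: in the induction, [(1 - x) * (1 - S)] exceeds [1 - x - S] by
    [x * S >= 0]. *)
Lemma prod_1B_ge (R : realFieldType) (I : Type) (s : seq I) (Q : pred I)
    (x : I -> R) : (forall i, 0 <= x i <= 1) ->
  1 - \sum_(i <- s | Q i) x i <= \prod_(i <- s | Q i) (1 - x i).
Proof.
move=> x01; elim: s => [|i s IHs]; first by rewrite !big_nil subr0.
rewrite !big_cons; case: ifP => // _.
have [x0 x1] := andP (x01 i).
have S0 : 0 <= \sum_(i <- s | Q i) x i.
  by apply: sumr_ge0 => j _; case/andP: (x01 j).
have := ler_wpM2l (_ : 0 <= 1 - x i) IHs; rewrite subr_ge0 => /(_ x1).
apply: le_trans; nra.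
Qed.

(** The right-hand side does not mention [h]: this is the form in which exchangeability is used. *)
Lemma iid_rectangle d (Omega : measurableType d) (R : realType)
    (P : probability Omega R) (F : probability R R) (I : finType)
    (Z : I -> {RV P >-> R}) m (h : 'I_m -> I) (B : 'I_m -> set R) :
  iid F Z -> injective h -> (forall i, measurable (B i)) ->
  P (\bigcap_i (Z (h i) @^-1` B i)) = (\prod_(i < m) F (B i))%E.
Proof.
move=> [indep law] hI mB.
(* The sets [B] are carried along [h]; independence is then applied to the image of [h] only. *)
pose C c := if [pick i | h i == c] is Some i then B i else setT.
have CE i : C (h i) = B i.
  rewrite /C; case: pickP => [j /eqP/hI -> //|/(_ i)]; by rewrite eqxx.
have mC c : measurable (C c) by rewrite /C; case: pickP.
have := indep [set h i | i in 'I_m]%SET C mC.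
rewrite big_imset/=; last by move=> i j _ _ /hI.
have -> : \bigcap_(c in [set` [set h i | i in 'I_m]%SET]) (Z c @^-1` C c) =
    \bigcap_i (Z (h i) @^-1` B i).
  apply/seteqP; split=> w wC c.
    by move=> _; rewrite -CE; apply: wC => /=; rewrite imset_f.
  by move=> /imsetP[i _ ->]/=; rewrite CE; exact: wC.
move=> ->; rewrite big_mkcond/=; apply: eq_bigr => i _.
by rewrite CE; exact: law.
Qed.

(** * Sliding windows and the stopping rule *)

Section Window.
Variable k : nat.

Lemma window_subproof (i b : 'I_k.+1) : (i + b < k + k.+1)%N.
Proof. by have := ltn_ord i; have := ltn_ord b; lia. Qed.

(** Positions refer to the [k] samples followed by the [k.+1] values. Window [i] therefore ends, at
    [b = ord_max], with the value of time [i]. *)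
Definition window (i b : 'I_k.+1) : 'I_(k + k.+1) := Ordinal (window_subproof i b).

Lemma window_inj i : injective (window i).
Proof. by move=> a b /(congr1 val)/= /addnI/val_inj. Qed.

Lemma recent_subproof (i b : 'I_k.+1) : (i + b < k + i.+1)%N.
Proof. by have := ltn_ord b; lia. Qed.

(** The same positions as [window i], seen inside the shorter history known at time [i]. *)
Definition recent (i b : 'I_k.+1) : 'I_(k + i.+1) := Ordinal (recent_subproof i b).

(** The last position [i + k] of the later window lies beyond window [j], so the swap inside window
    [j] leaves it fixed. *)
Lemma window_swap (R : realFieldType) (z : 'I_(k + k.+1) -> R) (i j a : 'I_k.+1) :
  (j < i)%N ->
  argmax_weight (z \o tperm (window j a) (window j ord_max) \o window i) ord_max *
    argmax_weight (z \o tperm (window j a) (window j ord_max) \o window j) ord_max <=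
  argmax_weight (z \o window i) ord_max * argmax_weight (z \o window j) a.
Proof.
move=> ji; apply: argmax_weight_swap; try exact: window_inj.
- by rewrite -val_eqE/=; move: (ltn_ord a) => ak; lia.
- by rewrite -val_eqE/=; lia.
- move=> b /(congr1 val)/= iba.
  (* This is the place of position [j + k] in window [i]. The subtraction is not truncated, since a
     common entry gives [i <= i + b = j + a <= j + k]. *)
  have cP : (j + k - i < k.+1)%N by lia.
  exists (Ordinal cP); apply/val_inj => /=; have := ltn_ord a; lia.
Qed.

Context (R : realType).

Definition recent_max_prob (i : 'I_k.+1) (t : (k + i.+1).-tuple R) : R :=
  argmax_weight (fun b => tnth t (recent i b)) ord_max.

Lemma measurable_recent_max_prob (i : 'I_k.+1) :
  measurable_fun (@nonneg_orthant R (k + i.+1)) (@recent_max_prob i).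
Proof.
apply: measurable_funTS; apply: measurable_argmax_weight => b.
exact: measurable_tnth.
Qed.

Definition recent_max_rule : stopping_rule R k k.+1 :=
  StoppingRule (fun i t _ => argmax_weight_itv _ _) measurable_recent_max_prob.

(** Allows all decisions to be read off one full sequence, so that windows of different times can be
    compared. *)
Lemma tnth_history (s : k.-tuple R) (x : k.+1.-tuple R) (i b : 'I_k.+1) :
  tnth (history s x i) (recent i b) = tnth [tuple of s ++ x] (window i b).
Proof.
rewrite !(tnth_nth 0)/= !nth_cat size_tuple; case: ifPn => // ibk.
have mi : (i + b - k < i.+1)%N by have := ltn_ord b; lia.
have := tnth_mktuple (fun j : 'I_i.+1 => tnth x (widen_ord (ltn_ord i) j)) (Ordinal mi).
by rewrite (tnth_nth 0)/= => ->; rewrite (tnth_nth 0).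
Qed.

Lemma recent_max_rule_stop_prob (s : k.-tuple R) (x : k.+1.-tuple R) (i : 'I_k.+1) :
  let W j := argmax_weight (fun b => tnth [tuple of s ++ x] (window j b)) ord_max in
  stop_at_prob recent_max_rule s x i =
  (\prod_(j < k.+1 | (j < i)%N) (1 - W j)) * W i.
Proof.
move=> W.
have WE j : recent_max_rule j (history s x j) = W j.
  by congr argmax_weight; apply/funext => b; exact: tnth_history.
by rewrite /stop_at_prob WE; congr (_ * _); apply: eq_bigr => j _; rewrite WE.
Qed.

End Window.

(** * Expected reward of the rule, in terms of its stopping probabilities *)

Section Guarantee.
Context (k : nat) (R : realType) (F : probability R R) (d : measure_display)
  (Omega : measurableType d) (P : probability Omega R)
  (S : 'I_k -> {RV P >-> R}) (X : 'I_k.+1 -> {RV P >-> R}).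
Hypothesis SX_iid : iid F (samples_and_values S X).

Let K := 'I_(k + k.+1).
Let Z (t : K) : {RV P >-> R} := samples_and_values S X (fintype.split t).
Let z w : K -> R := fun t => Z t w.
Let W (i a : 'I_k.+1) w : R := argmax_weight (z w \o window i) a.
(** Truncation at 0 makes every integrand nonnegative, so infinite expectations are covered too. It
    changes nothing almost surely once [F] lives on the nonnegative reals. *)
Let g (i : 'I_k.+1) w : R := Num.max (z w (window i ord_max)) 0.

Let Z_eq_integral m (h h' : 'I_m -> K) (f : m.-tuple R -> \bar R) :
  injective h -> injective h' -> measurable_fun setT f -> (forall t, 0 <= f t)%E ->
  (\int[P]_w f (observe (Z \o h) w) = \int[P]_w f (observe (Z \o h') w))%E.
Proof.
move=> hI h'I mf f0; apply: eq_integral_observe => // B mB.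
have sI : injective (@fintype.split k k.+1) by exact: can_inj splitK.
rewrite (iid_rectangle (h := fintype.split \o h) SX_iid)//; last exact: inj_comp.
by rewrite (iid_rectangle (h := fintype.split \o h') SX_iid)//; exact: inj_comp.
Qed.

Let tnth_observe m (h : 'I_m -> K) w : tnth (observe (Z \o h) w) = z w \o h.
Proof. by apply/funext => i; rewrite tnth_mktuple. Qed.

Let measurable_W i a : measurable_fun setT (W i a).
Proof. by apply: measurable_argmax_weight => b; exact: measurable_funP. Qed.

Let measurable_g i : measurable_fun setT (g i).
Proof. by apply: measurable_maxr => //; exact: measurable_funP. Qed.

Let g_ge0 i w : 0 <= g i w.
Proof. by rewrite le_max lexx orbT. Qed.

Let W_itv i a w : 0 <= W i a w <= 1.
Proof. exact: argmax_weight_itv. Qed.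

Let W_ge0 i a w : 0 <= W i a w.
Proof. exact: argmax_weight_ge0. Qed.

Let e : \bar R := (\int[P]_w (g ord_max w * W ord_max ord_max w)%:E)%E.

Let e_ge0 : (0 <= e)%E.
Proof. by apply: integral_ge0 => w _; rewrite lee_fin mulr_ge0. Qed.

(** Transposing [a] with the last place of the window moves the weight there; exchangeability then
    turns window [i] into the last window. *)
Let integral_gW i a :
  (\int[P]_w (Num.max (z w (window i a)) 0 * W i a w)%:E = e)%E.
Proof.
pose f (t : k.+1.-tuple R) : \bar R :=
  (Num.max (tnth t ord_max) 0 * argmax_weight (tnth t) ord_max)%:E.
have mf : measurable_fun setT f.
  apply/measurable_EFinP/measurable_funM.
    by apply: measurable_maxr => //; exact: measurable_tnth.
  by apply: measurable_argmax_weight => b; exact: measurable_tnth.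
have f0 t : (0 <= f t)%E.
  by rewrite lee_fin mulr_ge0 ?argmax_weight_ge0// le_max lexx orbT.
have pI : injective (window i \o tperm a ord_max).
  by apply: inj_comp; [exact: window_inj|exact: perm_inj].
transitivity (\int[P]_w f (observe (Z \o (window i \o tperm a ord_max)) w))%E.
  apply: eq_integral => w _; rewrite /f tnth_observe /=.
  rewrite (_ : z w \o (window i \o tperm a ord_max) =
    z w \o window i \o tperm a ord_max)//.
  by rewrite argmax_weight_comp tpermR.
rewrite (Z_eq_integral pI (@window_inj k ord_max) mf f0).
by apply: eq_integral => w _; rewrite /f tnth_observe.
Qed.

(** The last window starts at position [k], so it contains all the values and no sample. *)
Let window_max_value w : max_value X w = \big[Num.max/0]_a (z w \o window ord_max) a.
Proof.
apply: eq_bigr => a _ /=; rewrite /z /Z.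
rewrite (_ : window ord_max a = rshift k a); last exact: val_inj.
by rewrite (unsplitK (inr a : 'I_k + 'I_k.+1)).
Qed.

(** The maximum is distributed over the places of the last window by their weights, and each place
    contributes [e]. *)
Lemma expectation_max_value_le : ('E_P[max_value X] <= k.+1%:R%:E * e)%E.
Proof.
rewrite unlock.
have mG (a : 'I_k.+1) : measurable_fun setT
    (fun w => (Num.max (z w (window ord_max a)) 0 * W ord_max a w)%:E).
  apply/measurable_EFinP/measurable_funM => //.
  by apply: measurable_maxr => //; exact: measurable_funP.
have G0 (a : 'I_k.+1) w :
    (0 <= (Num.max (z w (window ord_max a)) 0 * W ord_max a w)%:E)%E.
  by rewrite lee_fin mulr_ge0// le_max lexx orbT.
apply: (@le_trans _ _ (\int[P]_w \sum_(a < k.+1)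
    (Num.max (z w (window ord_max a)) 0 * W ord_max a w)%:E)%E).
  apply: ge0_le_integral => //.
  - move=> w _; rewrite lee_fin window_max_value.
    exact: bigmax_ge_id.
  - by apply/measurable_EFinP/measurable_bigmaxr => a; exact: measurable_funP.
  - exact: emeasurable_sum.
  - move=> w _; rewrite window_max_value sumEFin lee_fin.
    by apply: le_sum_argmax_weight; rewrite card_ord.
rewrite ge0_integral_sum//; under eq_bigr do rewrite integral_gW.
by rewrite sumr_const card_ord mule_natl.
Qed.

(** Each of [k.+1] copies of the integral is rewritten by swapping another place [a] of window [j]
    with its last one. By [window_swap], copy [a] is at most the integral with [W j a] in place of
    [W j ord_max], and these weights sum to 1. *)
Let integral_gWW (i j : 'I_k.+1) : (j < i)%N ->
  (k.+1%:R%:E * \int[P]_w (g i w * W i ord_max w * W j ord_max w)%:E <= e)%E.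
Proof.
move=> ji.
pose f (t : (k + k.+1).-tuple R) : \bar R := (Num.max (tnth t (window i ord_max)) 0 *
  argmax_weight (tnth t \o window i) ord_max *
  argmax_weight (tnth t \o window j) ord_max)%:E.
have mf : measurable_fun setT f.
  apply/measurable_EFinP/measurable_funM; first apply: measurable_funM.
  - by apply: measurable_maxr => //; exact: measurable_tnth.
  - apply: (@measurable_argmax_weight _ _ _ _ (fun b t => tnth t (window i b))) => b.
    exact: measurable_tnth.
  - apply: (@measurable_argmax_weight _ _ _ _ (fun b t => tnth t (window j b))) => b.
    exact: measurable_tnth.
have f0 t : (0 <= f t)%E.
  rewrite lee_fin mulr_ge0 ?argmax_weight_ge0//.
  by rewrite mulr_ge0 ?argmax_weight_ge0// le_max lexx orbT.
have swapE a : (\int[P]_w (g i w * W i ord_max w * W j ord_max w)%:E =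
    \int[P]_w f (observe (Z \o tperm (window j a) (window j ord_max)) w))%E.
  rewrite -(Z_eq_integral (@inj_id _) (@perm_inj _ _) mf f0).
  by apply: eq_integral => w _; rewrite /f tnth_observe.
rewrite (_ : (_ * ?[x])%E = (\sum_(a < k.+1) ?x)%E); last first.
  by rewrite sumr_const card_ord mule_natl.
rewrite (eq_bigr _ (fun a _ => swapE a)).
rewrite -ge0_integral_sum//; last first.
  move=> a; apply: (measurableT_comp mf); exact: measurable_observe.
rewrite -(integral_gW i ord_max); apply: ge0_le_integral => //.
- by move=> w _; apply: sume_ge0.
- apply: emeasurable_sum => a; apply: (measurableT_comp mf); exact: measurable_observe.
- by apply/measurable_EFinP/measurable_funM; [exact: measurable_g|].
move=> w _; rewrite sumEFin lee_fin.
rewrite -[leRHS]mulr1 -[X in _ * X](sum_argmax_weight (z w \o window j)) ?card_ord//.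
rewrite mulr_sumr; apply: ler_sum => a _.
(* The swap fixes the last position of window [i], so the reward factor is unchanged. *)
rewrite tnth_observe -[leLHS]mulrA -[leRHS]mulrA /= tpermD; last 2 first.
- by rewrite -val_eqE/=; have := ltn_ord a; lia.
- by rewrite -val_eqE/=; lia.
by rewrite ler_wpM2l ?le_max ?lexx ?orbT//; exact: (window_swap (z w) a ji).
Qed.

Let p (i : 'I_k.+1) w : R :=
  (\prod_(j < k.+1 | (j < i)%N) (1 - W j ord_max w)) * W i ord_max w.

Let stop_probE i w :
  stop_at_prob (recent_max_rule k R) (observe S w) (observe X w) i = p i w.
Proof.
rewrite recent_max_rule_stop_prob /p.
have SXE : tnth [tuple of observe S w ++ observe X w] = z w.
  apply/funext => t; rewrite (tnth_nth 0).
  rewrite [LHS](nth_cat 0 (observe S w) (observe X w)) size_tuple /z /Z.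
  case: fintype.splitP => a ->.
    by rewrite -tnth_nth tnth_mktuple.
  by rewrite addKn -tnth_nth tnth_mktuple.
have WE j : argmax_weight
    (fun b => tnth [tuple of observe S w ++ observe X w] (window j b)) ord_max =
    W j ord_max w by rewrite SXE.
by rewrite WE; congr (_ * _); apply: eq_bigr => j _; rewrite WE.
Qed.

Let p_ge0 i w : 0 <= p i w.
Proof.
apply: mulr_ge0 => //; apply: prodr_ge0 => j _.
by rewrite subr_ge0; have /andP[] := W_itv j ord_max w.
Qed.

Let measurable_p i : measurable_fun setT (p i).
Proof.
apply: measurable_funM => //.
rewrite (_ : (fun w => _) = (fun w =>
    \prod_(j <- [seq j : 'I_k.+1 <- index_enum _ | (j < i)%N]) (1 - W j ord_max w))).
  by apply: measurable_prod => j _; exact: measurable_funB.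
by apply/funext => w; rewrite big_filter.
Qed.

(** For finite [e], time [i] earns at least [e] minus a loss [e / k.+1] for each of the [i] earlier
    times; the losses add up to [k * e / 2]. *)
Lemma sum_integral_stop_ge :
  ((2^-1)%:E * (k.+1%:R%:E * e) <= \sum_(i < k.+1) \int[P]_w (g i w * p i w)%:E)%E.
Proof.
have gp0 i : (0 <= \int[P]_w (g i w * p i w)%:E)%E.
  by apply: integral_ge0 => w _; rewrite lee_fin mulr_ge0.
(* At time 0 no earlier decision interferes, so the first term alone equals [e] and is infinite. *)
have [ey|efin] := eqVneq e +oo%E.
  suff gp_oo : (\int[P]_w (g ord0 w * p ord0 w)%:E = +oo)%E.
    rewrite (bigD1 ord0)//= gp_oo addye ?leey// -ltNye.
    by apply: (@lt_le_trans _ _ 0%E) => //; apply: sume_ge0.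
  rewrite -ey -(integral_gW ord0 ord_max); apply: eq_integral => w _.
  by rewrite /p big_pred0_eq mul1r.
have {efin} ce : e = (fine e)%:E.
  by rewrite fineK// ge0_fin_numE// ltey.
set c := fine e in ce.
have c0 : 0 <= c by exact: fine_ge0.
have stop_ge (i : 'I_k.+1) :
    ((c - i%:R * (c / k.+1%:R))%:E <= \int[P]_w (g i w * p i w)%:E)%E.
  (* Moving the loss to the right leaves only integrals of nonnegative functions to compare. *)
  rewrite EFinB leeBlDr//.
  pose u (j : 'I_k.+1) w := g i w * W i ord_max w * W j ord_max w.
  have mu j : measurable_fun setT (EFin \o u j).
    by apply/measurable_EFinP/measurable_funM => //; exact: measurable_funM.
  have u0 j w : (0 <= (u j w)%:E)%E.
    by rewrite lee_fin (mulr_ge0 (mulr_ge0 (g_ge0 _ _) (W_ge0 _ _ _)) (W_ge0 _ _ _)).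
  have intu (j : 'I_k.+1) : (j < i)%N -> (\int[P]_w (u j w)%:E <= (c / k.+1%:R)%:E)%E.
    move=> /integral_gWW; rewrite ce muleC -lee_pdivlMr//.
  apply: (@le_trans _ _ (\int[P]_w (g i w * p i w)%:E +
      \sum_(j < k.+1 | (j < i)%N) \int[P]_w (u j w)%:E)%E); last first.
    rewrite leeD2l//; apply: le_trans (lee_sum _ (fun j => @intu j)) _.
    rewrite sumEFin lee_fin sumr_const mulr_natl.
    rewrite (_ : #|_| = i)//.
    rewrite -[RHS](card_ord i) -sum1_card -[RHS]sum1_card.
    by rewrite (big_ord_widen k.+1 (fun=> 1%N)) // ltnW.
  rewrite -big_filter -ge0_integral_sum//.
  rewrite -ge0_integralD//; last 4 first.
  - by move=> w _; rewrite lee_fin mulr_ge0.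
  - by apply/measurable_EFinP/measurable_funM.
  - by move=> w _; apply: sume_ge0.
  - exact: emeasurable_sum.
  rewrite -ce -(integral_gW i ord_max).
  apply: ge0_le_integral => //.
  - by move=> w _; rewrite lee_fin mulr_ge0//; exact: g_ge0.
  - by apply/measurable_EFinP/measurable_funM; [exact: measurable_g|].
  - apply: emeasurable_funD; last exact: emeasurable_sum.
    by apply/measurable_EFinP/measurable_funM.
  move=> w _; rewrite sumEFin -EFinD lee_fin big_filter /u.
  have -> : \sum_(j < k.+1 | (j < i)%N) g i w * W i ord_max w * W j ord_max w =
    g i w * (W i ord_max w * \sum_(j < k.+1 | (j < i)%N) W j ord_max w).
    by rewrite -mulr_sumr -mulrA.
  rewrite -mulrDr; apply: ler_wpM2l; first exact: g_ge0.
  rewrite /p.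
  have := prod_1B_ge (index_enum _) (fun j : 'I_k.+1 => (j < i)%N)
    (fun j => W_itv j ord_max w).
  by move=> /(ler_wpM2r (W_ge0 i ord_max w)); lra.
apply: le_trans (lee_sum _ (fun i _ => stop_ge i)).
rewrite sumEFin ce -!EFinM lee_fin big_split/= sumr_const card_ord sumrN -mulr_suml.
rewrite -mulr_natl.
have -> : \sum_(i < k.+1) i%:R = k.+1%:R * k%:R / 2 :> R.
  elim: (k) => [|m IHm]; first by rewrite big_ord1 mulr0 mul0r.
  rewrite big_ord_recr/= IHm -[m.+2]addn1 -[m.+1]addn1 !natrD; lra.
have -> : k.+1%:R * k%:R / 2 * (c / k.+1%:R) = k%:R * c / 2 :> R.
  have : k.+1%:R != 0 :> R by rewrite pnatr_eq0.
  by move: (k.+1%:R : R) => m m0; field.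
(* The terms total [(k + 2) * c / 2], which exceeds the required [(k + 1) * c / 2] by [c / 2]. *)
rewrite -[k.+1]addn1 natrD; have : 0 <= k%:R :> R by []; nra.
Qed.


(** * Passage from stopping probabilities to the stopping time *)

Let nonneg_event : set Omega := [set w | forall t, 0 <= z w t].

Let nonneg_eventE : nonneg_event = \bigcap_t (Z t @^-1` `[0, +oo[).
Proof.
apply/seteqP; split=> w D t => [_|]; first by rewrite /= in_itv/= andbT; exact: D.
by have := D t I; rewrite /= in_itv/= andbT.
Qed.

Let measurable_nonneg_event : measurable nonneg_event.
Proof.
rewrite nonneg_eventE; apply: fin_bigcap_measurable; first exact: finite_finset.
by move=> t _; rewrite -[_ @^-1` _]setTI; exact: measurable_funP.
Qed.

Let P_nonneg_event : F `[0, +oo[%classic = 1%E -> P (~` nonneg_event) = 0%E.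
Proof.
move=> F0; rewrite probability_setC//.
rewrite nonneg_eventE.
rewrite (iid_rectangle (h := fintype.split) SX_iid (B := fun=> `[0, +oo[%classic))//.
  by rewrite big1 ?subee// => t _; exact: F0.
exact: can_inj splitK.
Qed.

Let X_window i w : X i w = z w (window i ord_max).
Proof.
rewrite /z /Z (_ : window i ord_max = rshift k i); last by apply/val_inj/addnC.
by rewrite (unsplitK (inr i : 'I_k + 'I_k.+1)).
Qed.

(** [stopping_time_of] equates the integrals of the indicator and of [p i] over events on which the
    observations are nonnegative. Applied to the events that [X i] lies in [B], it lets the two be
    exchanged against the truncated value, a function of [X i]. *)
Lemma integral_stop_at (tau : Omega -> option 'I_k.+1) (i : 'I_k.+1) :
  stopping_time_of (recent_max_rule k R) S X tau ->
  (\int[P]_(w in nonneg_event) (g i w * \1_[set w | tau w = Some i] w)%:E =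
   \int[P]_(w in nonneg_event) (g i w * p i w)%:E)%E.
Proof.
move=> /(_ i)[mtau tau_p].
pose phi (x : R) : \bar R := (Num.max x 0)%:E.
have mphi : measurable_fun setT phi.
  by apply/measurable_EFinP; apply: (measurable_maxr (f := id) (g := cst 0)).
have phi0 x : (0 <= phi x)%E by rewrite lee_fin le_max lexx orbT.
have mX : measurable_fun setT (X i : Omega -> R) by exact: measurable_funP.
have gphi f : (\int[P]_(w in nonneg_event) (g i w * f w)%:E =
    \int[P]_(w in nonneg_event) (phi (X i w) * (f w)%:E))%E.
  by apply: eq_integral => w _; rewrite /phi X_window EFinM.
rewrite (gphi (\1_[set w | tau w = Some i])) (gphi (p i)).
have mD := measurable_nonneg_event.
have mtau1 : measurable_fun setT (\1_[set w | tau w = Some i] : Omega -> R).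
  exact: measurable_indic.
apply: (ge0_integral_comp_eq mD mX mtau1 (measurable_p i) _ (p_ge0 i) _ mphi phi0)
  => // B mB.
have mXB : measurable (nonneg_event `&` X i @^-1` B).
  by apply: measurableI => //; rewrite -[_ @^-1` _]setTI; exact: mX.
rewrite integral_indic//.
(* The orthants bring [A] within the scope of [stopping_time_of]; its preimage is the nonnegativity
   event intersected with that of [B]. *)
pose A : set (k.-tuple R * k.+1.-tuple R) :=
  (@nonneg_orthant R k `*` @nonneg_orthant R k.+1) `&`
  ((fun sx => tnth sx.2 i) @^-1` B).
have morthant m' : measurable (@nonneg_orthant R m').
  rewrite (_ : nonneg_orthant (m:=m') = rectangle (fun=> `[0, +oo[%classic)).
    by apply: measurable_rectangle.
  by apply/seteqP; split=> t tB j; have := tB j; rewrite /= in_itv/= andbT.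
have mA : measurable A.
  apply: measurableI; first exact: measurableX.
  rewrite -[_ @^-1` _]setTI.
  by apply: (measurableT_comp (measurable_tnth i) measurable_snd).
have AE : [set w | A (observe S w, observe X w)] = nonneg_event `&` X i @^-1` B.
  apply/seteqP; split=> w /=; rewrite /A /=.
    move=> [[Sw Xw]]; rewrite tnth_mktuple => XB; split=> // t.
    rewrite /z /Z; case: (fintype.split t) => a /=.
      by have := Sw a; rewrite tnth_mktuple.
    by have := Xw a; rewrite tnth_mktuple.
  move=> [D XB]; rewrite tnth_mktuple; split=> //; split=> a; rewrite tnth_mktuple.
    by have := D (unsplit (inl a)); rewrite /z /Z unsplitK.
  by have := D (unsplit (inr a)); rewrite /z /Z unsplitK.
have := tau_p A mA (@subIsetl _ _ _); rewrite /= AE => ->.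
by apply: eq_integral => w _; rewrite stop_probE.
Qed.

Lemma expectation_stopped_value (tau : Omega -> option 'I_k.+1) :
  F `[0, +oo[%classic = 1%E -> stopping_time_of (recent_max_rule k R) S X tau ->
  ('E_P[stopped_value X tau] = \sum_(i < k.+1) \int[P]_w (g i w * p i w)%:E)%E.
Proof.
move=> F0 tauP; rewrite unlock.
have N0 := P_nonneg_event F0.
have mtau i : measurable [set w | tau w = Some i] by have [] := tauP i.
have integral_nonneg_event (f : Omega -> \bar R) : measurable_fun setT f ->
    (forall w, 0 <= f w)%E -> (\int[P]_w f w = \int[P]_(w in nonneg_event) f w)%E.
  move=> mf f0; rewrite (ge0_negligible_integral _ measurableT mf _ N0)//.
    by rewrite setTD setCK.
  exact: measurableC.
(* At most one indicator is nonzero, and never stopping gives the empty reward 0. *)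
have stopE (f : 'I_k.+1 -> R) w :
    \sum_(i < k.+1) f i * \1_[set w | tau w = Some i] w =
    if tau w is Some i then f i else 0.
  case tauw : (tau w) => [i|]; last first.
    by rewrite big1// => j _; rewrite indicE memNset ?mulr0//= tauw.
  rewrite (bigD1 i)//= indicE mem_set// mulr1 big1 ?addr0// => j ji.
  by rewrite indicE memNset ?mulr0//= tauw => -[/esym/eqP]; apply/negP.
have mg1 i : measurable_fun setT (fun w => g i w * \1_[set w | tau w = Some i] w).
  by apply: measurable_funM => //; exact: measurable_indic.
(* The reward is split by stopping time, and each value is replaced by its truncation, to which it
   is equal on [nonneg_event]. *)
transitivity (\int[P]_w (\sum_(i < k.+1) (g i w * \1_[set w | tau w = Some i] w)%:E))%E.
  apply: ae_eq_integral => //.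
  - apply/measurable_EFinP.
    rewrite (_ : stopped_value X tau =
      fun w => \sum_(i < k.+1) X i w * \1_[set w | tau w = Some i] w).
      by apply: measurable_sum => i; apply: measurable_funM => //; exact: measurable_indic.
    by apply/funext => w; rewrite stopE.
  - by apply: emeasurable_sum => i; exact/measurable_EFinP.
  exists (~` nonneg_event); split => //; first exact: measurableC.
  apply: subsetC => w D _ /=.
  rewrite sumEFin (stopE (g ^~ w)) /stopped_value; case: (tau w) => // i.
  by rewrite X_window /g max_l.
rewrite ge0_integral_sum//; last 2 first.
- by move=> i; exact/measurable_EFinP.
- by move=> i w _; rewrite lee_fin mulr_ge0.
apply: eq_bigr => i _.
rewrite [LHS]integral_nonneg_event; last 2 first.
- exact/measurable_EFinP.
- by move=> w; rewrite lee_fin mulr_ge0.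
rewrite [RHS]integral_nonneg_event; last 2 first.
- by apply/measurable_EFinP/measurable_funM.
- by move=> w; rewrite lee_fin mulr_ge0.
exact: integral_stop_at.
Qed.

Lemma recent_max_rule_guarantee (tau : Omega -> option 'I_k.+1) :
  F `[0, +oo[%classic = 1%E -> stopping_time_of (recent_max_rule k R) S X tau ->
  ((2^-1)%:E * 'E_P[max_value X] <= 'E_P[stopped_value X tau])%E.
Proof.
move=> F0 tauP; rewrite (expectation_stopped_value F0 tauP).
apply: le_trans sum_integral_stop_ge.
by rewrite lee_wpmul2l ?lee_fin ?invr_ge0//; exact: expectation_max_value_le.
Qed.

End Guarantee.

Theorem theorem13 (R : realType) (n : nat) (n_ge1 : (1 <= n)%N) :
  exists r : stopping_rule R n.-1 n,
    forall F : probability R R, F `[0, +oo[%classic = 1%E ->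
    forall (d : measure_display) (Omega : measurableType d)
      (P : probability Omega R)
      (S : 'I_n.-1 -> {RV P >-> R}) (X : 'I_n -> {RV P >-> R})
      (tau : Omega -> option 'I_n),
      iid F (samples_and_values S X) ->
      stopping_time_of r S X tau ->
      ('E_P[stopped_value X tau] >= (2^-1)%:E * 'E_P[max_value X])%E.
Proof.
case: n n_ge1 => // k _; exists (recent_max_rule k R) => F F0 d Omega P S X tau SX.
exact: recent_max_rule_guarantee SX tau F0.
Qed.
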